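(* The following Wilf equivalences between patterns of length $4$ over inversion sequences hold: \[ \begin{gathered} 1011 \equiv 1101 \equiv 1110,\\ 2110 \equiv 2101 \equiv 2011,\\ 0221 \equiv 0212,\\ 0312 \equiv 0321,\\ 1102 \equiv 1012,\\ 2201 \equiv 2210,\\ 2301 \equiv 2310,\\ 3201 \equiv 3210. \end{gathered} \] Here $\pi\equiv\sigma$ means that $|\mathbf{I}_n(\pi)|=|\mathbf{I}_n(\sigma)|$ for all $n\ge 1$.
   Context: An inversion sequence of length $n$ is a sequence of integers $e=e_1\cdots e_n$ with $0\le e_i<i$ for all $1\le i\le n$; the set of these is $\mathbf{I}_n$. A pattern is a finite sequence of integers $\pi=\pi_1\cdots\pi_k$ (written as a word, e.g. $1011$ means $(1,0,1,1)$). Two integer sequences of the same length $k$, $\pi$ and $\sigma$, are order isomorphic if for all $i,j\in\{1,\dots,k\}$ the relation ($<$, $=$ or $>$) between $\pi_i$ and $\pi_j$ is the same as that between $\sigma_i$ and $\sigma_j$. A sequence $e$ of length $n$ contains a pattern $\pi$ of length $k$ if there are indices $1\le i_1<\cdots<i_k\le n$ such that $e_{i_1}\cdots e_{i_k}$ is order isomorphic to $\pi$; otherwise $e$ avoids $\pi$. $\mathbf{I}_n(\pi)$ denotes the set of $e\in\mathbf{I}_n$ that avoid $\pi$. *)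

(* Defs.v *)
From mathcomp Require Import all_boot.

Set Implicit Arguments.
Unset Strict Implicit.
Unset Printing Implicit Defensive.

(* The relation > between s_i and s_j is covered by the pair (j, i). *)
Definition order_iso (s t : seq nat) : bool :=
  (size s == size t) &&
  [forall i : 'I_(size s), forall j : 'I_(size s),
     ((nth 0 s i < nth 0 s j) == (nth 0 t i < nth 0 t j))
  && ((nth 0 s i == nth 0 s j) == (nth 0 t i == nth 0 t j))].

Definition contains (e p : seq nat) : bool :=
  [exists f : {ffun 'I_(size p) -> 'I_(size e)},
     [forall i : 'I_(size p), forall j : 'I_(size p), (i < j) ==> (f i < f j)]
  && order_iso [seq nth 0 e (f i) | i <- enum 'I_(size p)] p].

Definition avoids (e p : seq nat) : bool := ~~ contains e p.

(* The entries e_1, ..., e_n of an inversion sequence are all < n, so 'I_n can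
   hold them.  As i counts from 0, the condition e_i < i of the 1-indexed
   convention reads e_i < i.+1. *)
Definition inv_seqs (n : nat) : {set n.-tuple 'I_n} :=
  [set e : n.-tuple 'I_n | [forall i : 'I_n, tnth e i < i.+1]].

Definition inv_seqs_avoiding (n : nat) (p : seq nat) : {set n.-tuple 'I_n} :=
  [set e in inv_seqs n | avoids (map (@nat_of_ord n) e) p].

Definition wilf_equiv (p q : seq nat) : Prop :=
  forall n : nat, 1 <= n -> #|inv_seqs_avoiding n p| = #|inv_seqs_avoiding n q|.

(* Main.v *)
Require Import Defs.
From mathcomp Require Import all_boot.
From mathcomp Require Import zify.

Set Implicit Arguments.
Unset Strict Implicit.
Unset Printing Implicit Defensive.

(** Each pattern is a word 1^a 0 1^b (up to relabelling) together with a fixed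
    context: possibly a leading 0, which the first entry always provides, and
    then nothing, a final larger letter, or a prefix of one or two larger
    letters.  The context is present exactly when the cells (column, value) of
    the word are "marked" by other entries, and redistributing the marked
    entries among the marked cells does not change which cells are marked.  So
    fix the unmarked entries and fill the marked columns value by value, from
    the largest value down.  The pattern is avoided iff at every value v the 0/1
    word recording which of the still open columns receive v does not contain
    1^a 0 1^b as a subsequence, and the number of ways to continue depends only
    on how many columns were used.  Finally, the number of 0/1 words with given
    length and number of ones that avoid 1^a 0 1^b depends only on a + b. *)

(** * Binary words *)

Definition bit_pattern (a b : nat) : bitseq := nseq a true ++ false :: nseq b true.

Lemma rev_bit_pattern a b : rev (bit_pattern a b) = bit_pattern b a.
Proof.
by rewrite /bit_pattern rev_cat rev_cons !rev_nseq cat_rcons.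
Qed.

Lemma subseq_bit_pattern_rev a b w :
  subseq (bit_pattern a b) w = subseq (bit_pattern b a) (rev w).
Proof. by rewrite -(rev_bit_pattern a b) subseq_rev. Qed.

(* Every word containing a one is 0^g 1 u; it contains 1^(a+1) 0 1^b iff u contains
   1^a 0 1^b.  Reversing u therefore exchanges 1^(a+1) 0 1^b with 1^(b+1) 0 1^a. *)
Fixpoint flip (w : bitseq) : bitseq :=
  match w with
  | [::] => [::]
  | true :: w' => true :: rev w'
  | false :: w' => false :: flip w'
  end.

Lemma flipK : involutive flip.
Proof. by elim=> [|[] w IH] //=; rewrite ?revK ?IH. Qed.

Lemma size_flip w : size (flip w) = size w.
Proof. by elim: w => [|[] w IH] //=; rewrite ?size_rev ?IH. Qed.

Lemma count_flip w : count id (flip w) = count id w.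
Proof. by elim: w => [|[] w IH] //=; rewrite ?count_rev ?IH. Qed.

Lemma subseq_bit_pattern_flip a b w :
  subseq (bit_pattern a.+1 b) w = subseq (bit_pattern b.+1 a) (flip w).
Proof. by elim: w => [|[] w IH] //=; apply: subseq_bit_pattern_rev. Qed.

(* The number of ways to distribute the values L + i - 1, ..., L over [t] columns,
   when [N w] of them admit the value [w]. *)
Fixpoint level_count (L : nat) (p : bitseq) (i : nat) (N : nat -> nat) (t : nat) : nat :=
  if i is i'.+1 then
    \sum_(beta : (N (L + i')).-tuple bool | ~~ subseq p beta)
      level_count L p i' (fun w => N w - count id beta) (t - count id beta)
  else t == 0.

(** At each value [phi] permutes the candidate words, exchanging avoidance of [p] and of [q]; the
    rest of the recursion sees [beta] only through its number of ones, which [phi] keeps. *)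
Lemma level_count_reindex L p q phi i N t :
  involutive phi -> (forall w, size (phi w) = size w) ->
  (forall w, count id (phi w) = count id w) ->
  (forall w, subseq p w = subseq q (phi w)) ->
  level_count L p i N t = level_count L q i N t.
Proof.
move=> phiK sz ct pq; elim: i N t => //= i IH N t.
(* [phi] preserves sizes, so it lifts to tuples by casting. *)
have [F FE] : exists F : (N (L + i)).-tuple bool -> (N (L + i)).-tuple bool,
    forall x, F x = phi x :> seq bool.
  exists (fun x => tcast (size_tuple x) (tcast (sz x) (in_tuple (phi x)))) => x.
  by rewrite !val_tcast.
have FK : involutive F by move=> x; apply/val_inj; rewrite /= !FE phiK.
rewrite [RHS](reindex_inj (inv_inj FK)); apply: eq_big => x; first by rewrite FE pq.
by move=> _; rewrite FE ct IH.
Qed.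

(** [flip] leads from 1^(a+1) 0 1^b to 1^(b+1) 0 1^a, and reversal from there to 1^a 0 1^(b+1). *)
Lemma level_count_shift L a b i N t :
  level_count L (bit_pattern a.+1 b) i N t = level_count L (bit_pattern a b.+1) i N t.
Proof.
rewrite (level_count_reindex _ _ _ _ flipK size_flip count_flip (subseq_bit_pattern_flip a b)).
exact: (level_count_reindex _ _ _ _ revK (@size_rev _) (count_rev _)
  (subseq_bit_pattern_rev _ _)).
Qed.

(** * Filling columns value by value *)

Section Filling.
(* [m c v]: the column [c] admits the value [v]. *)
Variables (n L : nat) (m : 'I_n -> nat -> bool) (p : bitseq).
Hypothesis m_mono : forall c v w, L <= w <= v -> m c v -> m c w.

Implicit Types (A : {set 'I_n}) (e s : n.-tuple 'I_n).

(** Values are placed from the top down, so a column holding more than [v] is already used up and is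
    skipped. *)
Definition level A e v : bitseq :=
  [seq tnth e c == v :> nat | c <- enum 'I_n & [&& c \in A, m c v & tnth e c <= v]].

(** [s] supplies the entries off [A]: in the induction, columns already filled leave [A] and are
    frozen in [s]. *)
Definition filling v A s : {set n.-tuple 'I_n} :=
  [set e : n.-tuple 'I_n |
    [forall c, if c \in A then [&& L <= tnth e c, tnth e c < v & m c (tnth e c)]
               else tnth e c == tnth s c]
    && [forall w : 'I_v, (L <= w) ==> ~~ subseq p (level A e w)]].

Lemma fillingP v A s e :
  reflect [/\ forall c, c \in A -> [/\ L <= tnth e c, tnth e c < v & m c (tnth e c)],
              forall c, c \notin A -> tnth e c = tnth s c
            & forall w, L <= w < v -> ~~ subseq p (level A e w)]
          (e \in filling v A s).
Proof.
rewrite inE; apply: (iffP andP) => [[/forallP h1 /forallP h2]|[h1 h2 h3]]; split.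
- by move=> c cA; have := h1 c; rewrite cA => /and3P.
- by move=> c cA; have := h1 c; rewrite (negbTE cA) => /eqP.
- by move=> w /andP[Lw wv]; have := h2 (Ordinal wv); rewrite /= Lw.
- apply/forallP => c; case: ifPn => cA; first by apply/and3P; apply: h1.
  by apply/eqP; apply: h2.
- by apply/forallP => w; apply/implyP => Lw; apply: h3; rewrite Lw ltn_ord.
Qed.

(** Induction on the number of values: the fillings are split by the word [beta] that the largest
    value spells, and each class is a set of fillings of the columns that remain. *)
Lemma card_filling i A s N :
  L + i <= n -> (forall w, L <= w < L + i -> #|[set c in A | m c w]| = N w) ->
  #|filling (L + i) A s| = level_count L p i N #|A|.
Proof.
elim: i A s N => [|i IH] A s N.
  (* With no value left, only an empty [A] can be filled, and only by [s]. *)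
  move=> _ _ /=; rewrite addn0; have [A0|[c cA]] := set_0Vmem A.
    suff -> : filling L A s = [set s] by rewrite cards1 A0 cards0.
    apply/setP => e; rewrite in_set1; apply/fillingP/eqP => [[_ h _]|->].
      by apply: eq_from_tnth => c; apply: h; rewrite A0 inE.
    by split=> [c||w /andP[/leq_ltn_trans h /h]]; rewrite ?A0 ?inE ?ltnn.
  rewrite -[#|A|]prednK /=; last by apply/card_gt0P; exists c.
  apply/eqP; rewrite cards_eq0; apply/eqP/setP => e; rewrite in_set0.
  by apply/negP => /fillingP[/(_ _ cA)[h1 h2 _] _ _]; lia.
rewrite addnS => ltn NE /=; set v := L + i in ltn NE *.
pose vo := Ordinal ltn; pose B := [set c in A | m c v].
have cB : #|B| = N v by apply: NE; rewrite ltnSn leq_addr.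
pose key e : (N v).-tuple bool :=
  tcast cB (map_tuple (fun c => tnth e c == v :> nat) (enum_tuple B)).
have keyE e : key e = [seq tnth e c == v :> nat | c <- enum B] :> seq bool.
  by rewrite val_tcast.
rewrite -sum1_card (partition_big key xpredT) //= [RHS]big_mkcond /=.
apply: eq_bigr => beta _; rewrite sum1dep_card.
(* The columns that receive [v] when the word is [beta]. *)
pose S := [set c in B | nth false beta (index c (enum B))].
have SB : S \subset B by apply/subsetP => c; rewrite inE => /andP[].
have BA : B \subset A by apply/subsetP => c; rewrite inE => /andP[].
have szB : size (enum B) = size beta by rewrite -cardE cB size_tuple.
have betaE : [seq c \in S | c <- enum B] = beta.
  apply: (@eq_from_nth _ false); first by rewrite size_map szB.
  move=> k; rewrite size_map => kB.
  rewrite (nth_map vo) // inE index_uniq ?enum_uniq //.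
  by rewrite -mem_enum mem_nth.
have cS : #|S| = count id beta.
  rewrite -betaE count_map -size_filter cardE; congr size.
  rewrite {1}/enum_mem /enum_mem -filter_predI; apply: eq_filter => c /=.
  by case: (boolP (c \in S)) => // /(subsetP SB) ->.
have key_eq e : key e = beta <-> {in B, forall c, (tnth e c == v :> nat) = (c \in S)}.
  split=> [/(congr1 val)/=|h].
    by rewrite keyE -betaE => /eq_in_map h c cBin; apply: h; rewrite mem_enum.
  apply: val_inj; rewrite /= keyE -betaE; apply/eq_in_map => c.
  by rewrite mem_enum; apply: h.
(* No entry in [A] exceeds the top value, so every column of [B] is still open. *)
have levelE e : (forall c, c \in A -> tnth e c <= v) -> level A e v = key e.
  move=> le_v; rewrite keyE /level; congr map; rewrite {2}/enum_mem enumT.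
  apply: eq_filter => c; rewrite !inE; case: (boolP (c \in A)) => //= cA.
  by rewrite le_v // andbT.
case: ifP => [good|bad]; last first.
  apply/eqP; rewrite cards_eq0; apply/eqP/setP => e; rewrite in_set0 in_set.
  apply/negP => /andP[/fillingP[h1 _ /(_ v)] + /eqP ke]; rewrite levelE ?ke ?bad ?leq_addr ?ltnSn.
    by move=> /(_ isT).
  by move=> c /h1[].
pose s' := [tuple if c \in S then vo else tnth s c | c < n].
have cAS : #|A :\: S| = #|A| - count id beta.
  by rewrite cardsD (setIidPr (subset_trans SB BA)) cS.
rewrite -cAS -(IH _ s'); first last.
(* By [m_mono] the columns of [S] also admit every lower [w], so each count drops by exactly the
   number of ones of [beta]. *)
- move=> w /andP[Lw wv]; rewrite -NE ?Lw ?ltnS ?(ltnW wv) // -cS.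
  rewrite -[X in _ = X](_ : #|[set c in A | m c w] :\: S| = _).
    congr #|pred_of_set _|; apply/setP => c; rewrite !inE.
    by case: (c \in A); rewrite ?andbT ?andbF.
  rewrite cardsD; congr (_ - #|pred_of_set _|); apply/setIidPr/subsetP => c /(subsetP SB).
  by rewrite !inE => /andP[-> mv]; apply: m_mono mv; rewrite Lw ltnW.
- exact: ltnW.
congr #|pred_of_set _|; apply/setP => e; rewrite in_set.
have AS c : c \in A :\: S = (c \in A) && (c \notin S) by rewrite inE andbC.
(* Columns of [S] hold [v > w], so they do not appear in lower levels anyway. *)
have levelD w : w < v -> (forall c, c \in S -> tnth e c = v :> nat) ->
    level (A :\: S) e w = level A e w.
  move=> wv hS; rewrite /level; congr map; apply: eq_filter => c; rewrite AS.
  by case: (boolP (c \in S)) => [/hS ->|_]; rewrite ?andbT // leqNgt wv !andbF.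
apply/andP/fillingP => [[/fillingP[h1 h2 h3] /eqP/key_eq ke]|[h1 h2 h3]].
  have hS c : c \in S -> tnth e c = v :> nat.
    by move=> cS'; apply/eqP; rewrite ke ?(subsetP SB).
  split=> [c|c|w /andP[Lw wv]].
  - rewrite AS => /andP[cA cS']; have [a1 a2 a3] := h1 c cA; split=> //.
    rewrite ltn_neqAle -ltnS a2 andbT; apply/negP => /eqP ev.
    have cBin : c \in B by rewrite inE cA; rewrite ev in a3.
    by move: cS'; rewrite -(ke c cBin) ev eqxx.
  - rewrite AS tnth_mktuple negb_and negbK; case: ifP => [cS' _|_].
      by apply: val_inj; apply: hS.
    by rewrite orbF; apply: h2.
  - by rewrite levelD // h3 // Lw ltnS ltnW.
have hS c : c \in S -> tnth e c = v :> nat.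
  by move=> cS'; rewrite h2 ?AS ?cS' ?andbF // tnth_mktuple cS'.
have hA c : c \in A -> [/\ L <= tnth e c, tnth e c < v.+1 & m c (tnth e c)].
  move=> cA; case: (boolP (c \in S)) => cS'.
    rewrite hS // leq_addr ltnSn; split=> //.
    by have := subsetP SB c cS'; rewrite inE => /andP[].
  have /h1[a1 a2 a3] : c \in A :\: S by rewrite AS cA.
  by split=> //; rewrite ltnS ltnW.
have ke : key e = beta.
  apply/key_eq => c cBin; case: (boolP (c \in S)) => [/hS ->|cS']; first exact: eqxx.
  have /h1[_ a2 _] : c \in A :\: S by rewrite AS cS' (subsetP BA).
  by rewrite ltn_eqF.
split; last exact/eqP.
apply/fillingP; split=> // [c cA|w /andP[Lw]].
  rewrite h2 ?AS ?(negbTE cA) // tnth_mktuple ifN //.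
  by apply: contra cA => /(subsetP SB)/(subsetP BA).
rewrite ltnS leq_eqVlt => /predU1P[->|wv]; last by rewrite -levelD // h3 ?Lw.
by rewrite levelE ?ke // => c /hA[].
Qed.

End Filling.

(** * Fixing the unmarked entries *)

Section Marking.
(* [m e c v]: the cell in column [c] and row [v] is marked by [e].  Taking [L = 1] keeps the
   zeros out of the word 1^a 0 1^b, for the patterns that start with their minimum. *)
Variables (n L : nat) (m : n.-tuple 'I_n -> 'I_n -> nat -> bool).
Implicit Types (e : n.-tuple 'I_n) (c : 'I_n).

Definition marked e c : bool := (L <= tnth e c) && m e c (tnth e c).

(** By [m_mono] below, every column read here holds a marked entry. *)
Definition profile e v : bitseq :=
  [seq tnth e c == v :> nat | c <- enum 'I_n & (L <= tnth e c <= v) && m e c v].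

Definition good p e := [forall v : 'I_n, (L <= v) ==> ~~ subseq p (profile e v)].

Hypothesis L_le_n : L <= n.
Hypothesis m_mono : forall e c v w, L <= w <= v -> m e c v -> m e c w.
(** Together with [m_stable]: moving marked entries among marked cells yields an inversion sequence
    again, with the same marks. *)
Hypothesis m_stair : forall e c w, e \in inv_seqs n -> m e c w -> w <= c.
Hypothesis m_stable : forall e e', e \in inv_seqs n -> e' \in inv_seqs n ->
  (forall c, tnth e' c = tnth e c \/
     marked e c /\ (L <= tnth e' c) && m e c (tnth e' c)) ->
  forall c w, L <= w -> m e' c w = m e c w.

(* A canonical representative of the sequences that differ from [e] only in the marked
   entries: lower these to the least admissible value. *)
Let lower e : n.-tuple 'I_n :=
  [tuple if marked e c then insubd (tnth e c) L else tnth e c | c < n].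

Let inv_seqsP e : reflect (forall c, tnth e c <= c) (e \in inv_seqs n).
Proof. by rewrite inE; apply: forallP. Qed.

Let marked_lower e c : marked e c -> tnth (lower e) c = L :> nat.
Proof.
move=> h; rewrite tnth_mktuple h val_insubd ifT //.
by have /andP[/leq_ltn_trans-> //] := h; apply: ltn_ord.
Qed.

Let unmarked_lower e c : ~~ marked e c -> tnth (lower e) c = tnth e c.
Proof. by move=> /negbTE h; rewrite tnth_mktuple h. Qed.

Let lower_in e : e \in inv_seqs n -> lower e \in inv_seqs n.
Proof.
move=> /inv_seqsP h; apply/inv_seqsP => c; have [k|k] := boolP (marked e c).
  by rewrite marked_lower //; have /andP[/leq_trans-> //] := k.
by rewrite unmarked_lower.
Qed.

Let m_lower e : e \in inv_seqs n -> forall c w, L <= w -> m (lower e) c w = m e c w.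
Proof.
move=> eI; apply: m_stable (lower_in eI) _ => // c.
have [k|k] := boolP (marked e c); [right|by left; apply: unmarked_lower].
rewrite marked_lower // leqnn; split=> //; have /andP[Le] := k.
by apply: m_mono; rewrite leqnn.
Qed.

Let marked_lowerE e c : e \in inv_seqs n -> marked (lower e) c = marked e c.
Proof.
move=> eI; rewrite /marked; have [k|k] := boolP (marked e c).
  rewrite m_lower // marked_lower // leqnn /=.
  by have /andP[Le mE] := k; rewrite Le mE (m_mono _ mE) ?leqnn.
by rewrite unmarked_lower //; case: (boolP (L <= _)) => //= Le; rewrite m_lower.
Qed.

Let lowerK e : e \in inv_seqs n -> lower (lower e) = lower e.
Proof.
move=> eI; apply: eq_from_tnth => c; have [k|k] := boolP (marked e c).
  by apply: ord_inj; rewrite !marked_lower ?marked_lowerE.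
by rewrite unmarked_lower ?marked_lowerE.
Qed.

(** [e] and [lower e] have the same marks in the rows from [L] on, so a fibre consists of the
    refillings of the marked columns of [k], and profiles become levels. *)
Let lower_fiber p k : k \in inv_seqs n -> lower k = k ->
  [set e in inv_seqs n | good p e && (lower e == k)]
  = filling L (m k) p n [set c | marked k c] k.
Proof.
move=> kI kk; apply/setP => e; rewrite in_set.
have levelE v : e \in inv_seqs n -> lower e = k -> L <= v ->
    level (m k) [set c | marked k c] e v = profile e v.
  move=> eI ek Lv; rewrite /level /profile; congr map; apply: eq_filter => c.
  rewrite inE -ek marked_lowerE // m_lower // /marked.
  have [Le|] := boolP (L <= tnth e c); rewrite //= [RHS]andbC.
  have [mv|] := boolP (m e c v); rewrite ?andbF //=.
  by have [ev|] := boolP (_ <= v); rewrite ?andbF // (m_mono _ mv) ?Le.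
apply/and3P/fillingP => [[eI /forallP gd /eqP ek]|[h1 h2 h3]].
  split=> [c|c|w /andP[Lw wn]].
  - rewrite inE -ek marked_lowerE // => /andP[Le me].
    by rewrite m_lower // Le ltn_ord me.
  - by rewrite inE -ek marked_lowerE // => hc; rewrite unmarked_lower.
  - by rewrite levelE //; have := gd (Ordinal wn); rewrite Lw.
have mk c : marked k c -> c \in [set c | marked k c] by rewrite inE.
have eI : e \in inv_seqs n.
  apply/inv_seqsP => c; have [kc|kc] := boolP (marked k c).
    by have /mk/h1[_ _ /(m_stair kI)] := kc.
  by rewrite h2 ?inE //; move: kI => /inv_seqsP.
have mE : forall c w, L <= w -> m e c w = m k c w.
  apply: m_stable => // c; have [kc|kc] := boolP (marked k c); [right|left].
    by split=> //; have /mk/h1[-> _ ->] := kc.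
  by rewrite h2 ?inE.
have ek : lower e = k.
  apply: eq_from_tnth => c; have [kc|kc] := boolP (marked k c).
    have ec : marked e c.
      by have /mk/h1[Le _ me] := kc; rewrite /marked Le mE.
    by apply: ord_inj; rewrite -[in RHS]kk !marked_lower.
  have ec : ~~ marked e c.
    have kec : tnth e c = tnth k c by rewrite h2 ?inE.
    by apply: contra kc; rewrite /marked kec => /andP[Le]; rewrite Le -mE.
  by rewrite unmarked_lower // h2 ?inE.
split=> //; last exact/eqP.
by apply/forallP => v; apply/implyP => Lv; rewrite -levelE // h3 // Lv ltn_ord.
Qed.

(** Summing over the fibres of [lower] reduces the claim to [level_count_shift]. *)
Lemma card_good_shift a b :
  #|[set e in inv_seqs n | good (bit_pattern a.+1 b) e]| =
  #|[set e in inv_seqs n | good (bit_pattern a b.+1) e]|.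
Proof.
have split_lower p : #|[set e in inv_seqs n | good p e]| =
    \sum_k #|[set e in inv_seqs n | good p e && (lower e == k)]|.
  rewrite -sum1_card (partition_big lower xpredT) //=; apply: eq_bigr => k _.
  rewrite sum1dep_card; apply: eq_card => e; rewrite !inE; exact: esym (andbA _ _ _).
rewrite !split_lower; apply: eq_bigr => k _.
(* As [lower] is idempotent on inversion sequences, only its fixed points have nonempty fibres. *)
have [/andP[kI /eqP kk]|kN] := boolP ((k \in inv_seqs n) && (lower k == k)).
  rewrite !lower_fiber //; set A := [set c | _].
  have fill p : #|filling L (m k) p n A k| =
      level_count L p (n - L) (fun w => #|[set c in A | m k c w]|) #|A|.
    have := @card_filling n L (m k) p (@m_mono k) (n - L) A k.
    by rewrite subnKC //; apply.
  by rewrite !fill level_count_shift.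
suff empty p : [set e in inv_seqs n | good p e && (lower e == k)] = set0 by rewrite !empty.
apply/setP => e; rewrite in_set0 in_set; apply: contraNF kN => /and3P[eI _ /eqP <-].
by rewrite lower_in // lowerK /=.
Qed.

End Marking.

Definition encodes (L : nat) (m : forall n, n.-tuple 'I_n -> 'I_n -> nat -> bool)
    (P : seq nat) (p : bitseq) : Prop :=
  forall n (e : n.-tuple 'I_n), e \in inv_seqs n ->
    avoids (map (@nat_of_ord n) e) P = good L (m n) p e.

Lemma wilf_equiv_shift (L a b : nat) (P Q : seq nat)
    (m : forall n, n.-tuple 'I_n -> 'I_n -> nat -> bool) :
  L <= 1 ->
  (forall n (e : n.-tuple 'I_n) c v w, L <= w <= v -> m n e c v -> m n e c w) ->
  (forall n (e : n.-tuple 'I_n) c w, e \in inv_seqs n -> m n e c w -> w <= c) ->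
  (forall n (e e' : n.-tuple 'I_n), e \in inv_seqs n -> e' \in inv_seqs n ->
    (forall c, tnth e' c = tnth e c \/
       marked L (@m n) e c /\ (L <= tnth e' c) && m n e c (tnth e' c)) ->
    forall c w, L <= w -> m n e' c w = m n e c w) ->
  encodes L m P (bit_pattern a.+1 b) -> encodes L m Q (bit_pattern a b.+1) ->
  wilf_equiv P Q.
Proof.
move=> L1 mono stair stable hP hQ n n1.
have avE R p : (forall e : n.-tuple 'I_n, e \in inv_seqs n ->
       avoids (map (@nat_of_ord n) e) R = good L (@m n) p e) ->
    inv_seqs_avoiding n R = [set e in inv_seqs n | good L (@m n) p e].
  by move=> h; apply/setP => e; rewrite [LHS]in_set [RHS]in_set; apply: andb_id2l => eI; apply: h.
rewrite (avE _ _ (hP n)) (avE _ _ (hQ n)); apply: card_good_shift => //.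
- exact: leq_trans n1.
- exact: mono.
- exact: stair.
- exact: stable.
Qed.

(** * Occurrences of patterns of length four *)

(** Bounded [all] over [iota] computes on explicit lists, leaving arithmetic for [lia]. *)
Lemma order_isoE s t :
  order_iso s t = (size s == size t) &&
  all (fun i => all (fun j => ((nth 0 s i < nth 0 s j) == (nth 0 t i < nth 0 t j))
    && ((nth 0 s i == nth 0 s j) == (nth 0 t i == nth 0 t j))) (iota 0 (size s)))
    (iota 0 (size s)).
Proof.
rewrite /order_iso; congr andb; apply/forallP/allP => [h i|h i].
  rewrite mem_iota => /= si; apply/allP => j; rewrite mem_iota => /= sj.
  exact: (forallP (h (Ordinal si)) (Ordinal sj)).
have iI : val i \in iota 0 (size s) by rewrite mem_iota ltn_ord.
by apply/forallP => j; apply: (allP (h _ iI)); rewrite mem_iota ltn_ord.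
Qed.

Lemma contains4P n (e : n.-tuple 'I_n) (a b c d : nat) :
  reflect (exists i j k l : 'I_n, [/\ i < j, j < k, k < l &
     order_iso [:: tnth e i : nat; tnth e j : nat; tnth e k : nat; tnth e l : nat]
       [:: a; b; c; d]])
   (contains (map (@nat_of_ord n) e) [:: a; b; c; d]).
Proof.
have sz : size (map (@nat_of_ord n) e) = n by rewrite size_map size_tuple.
have nthE (i : 'I_n) : nth 0 (map (@nat_of_ord n) e) i = tnth e i.
  by rewrite (nth_map i) ?size_tuple // -tnth_nth.
have enum4 : enum 'I_4 = [:: inord 0; inord 1; inord 2; inord 3].
  by apply: (inj_map val_inj); rewrite val_enum_ord /= !inordK.
apply: (iffP existsP) => [[f /andP[/forallP inc]]|].
  rewrite enum4 /= => oi.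
  have lt_f u v : u < v < 4 -> f (inord u) < f (inord v).
    move=> /andP[uv v4]; apply: implyP (forallP (inc _) _) _.
    by rewrite !inordK // (ltn_trans uv v4).
  exists (cast_ord sz (f (inord 0))), (cast_ord sz (f (inord 1))),
         (cast_ord sz (f (inord 2))), (cast_ord sz (f (inord 3))).
  by split; rewrite ?lt_f // -!nthE.
move=> [i [j [k [l [ij jk kl oi]]]]].
exists [ffun x : 'I_4 => cast_ord (esym sz) (nth i [:: i; j; k; l] x)].
rewrite enum4 /= !ffunE !inordK //= !nthE oi andbT.
apply/forallP => x; apply/forallP => y; rewrite !ffunE /=; apply/implyP.
by case: x y => [[|[|[|[|x]]]] hx] [[|[|[|[|y]]]] hy] //=; lia.
Qed.

Lemma subseq_filter_enumP (n : nat) (P f : 'I_n -> bool) (p : bitseq) :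
  reflect (exists cs : seq 'I_n, [/\ sorted (fun x y : 'I_n => x < y) cs, all P cs
             & [seq f c | c <- cs] = p])
          (subseq p [seq f c | c <- enum 'I_n & P c]).
Proof.
have tr : transitive (fun x y : 'I_n => x < y) by move=> y x z; apply: ltn_trans.
have se : sorted (fun x y : 'I_n => x < y) (filter P (enum 'I_n)).
  apply: sorted_filter => //; have := iota_ltn_sorted 0 n.
  by rewrite -val_enum_ord sorted_map.
apply: (iffP idP) => [/subseqP[msk _ ->]|[cs [h1 h2 <-]]].
  exists (mask msk (filter P (enum 'I_n))).
  have sm := mask_subseq msk (filter P (enum 'I_n)).
  split; [exact: subseq_sorted sm se | | exact: map_mask].
  by apply/allP => c /(mem_subseq sm); rewrite mem_filter => /andP[].
apply: map_subseq.
(* A strictly increasing list is determined by its members, so [cs] is a filter of the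
   enumeration. *)
rewrite (_ : cs = [seq c <- filter P (enum 'I_n) | c \in cs]) ?filter_subseq //.
apply: (irr_sorted_eq tr) => //; first by move=> x; apply: ltnn.
  exact: sorted_filter.
move=> c; rewrite 2!mem_filter mem_enum andbT; case: (boolP (c \in cs)) => // cc.
by rewrite (allP h2).
Qed.

Lemma avoids_good n L (m : n.-tuple 'I_n -> 'I_n -> nat -> bool) (e : n.-tuple 'I_n) P p :
  (contains (map (@nat_of_ord n) e) P <->
     exists v : 'I_n, L <= v /\ exists cs : seq 'I_n,
       [/\ sorted (fun x y : 'I_n => x < y) cs,
           all (fun c => (L <= tnth e c <= v) && m e c v) cs
         & [seq tnth e c == v :> nat | c <- cs] = p]) ->
  avoids (map (@nat_of_ord n) e) P = good L m p e.
Proof.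
move=> [h1 h2]; rewrite /avoids /good; apply/idP/forallP => [|h].
  move=> nc v; apply/implyP => Lv; apply: contra nc => /subseq_filter_enumP[cs hcs].
  by apply: h2; exists v; split=> //; exists cs.
apply/negP => /h1[v [Lv [cs hcs]]]; have := h v; rewrite Lv => /negP; apply.
by apply/subseq_filter_enumP; exists cs.
Qed.

(** * Markings by position alone and by larger entries to one side *)

Definition stair_mark n (e : n.-tuple 'I_n) (c : 'I_n) (w : nat) : bool := w <= c.

Section PairMark.
Variables (mu : nat -> nat -> nat) (R : nat -> nat -> nat -> nat -> bool).
Variable n : nat.
Implicit Types (e : n.-tuple 'I_n) (c : 'I_n) (w : nat).

(* [mu n] decreases from the cell towards the marking entries: columns to the left for
   [mu n c = c], to the right for [mu n c = n - c].  Taking [c1 = c2] gives the marking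
   by a single entry. *)
Definition pair_mark e c w : bool :=
  (w <= c) && [exists c1 : 'I_n, exists c2 : 'I_n,
    [&& mu n c1 < mu n c, mu n c2 < mu n c, w < tnth e c1, w < tnth e c2
      & R c1 c2 (tnth e c1) (tnth e c2)]].

Lemma pair_markP e c w :
  reflect (w <= c /\ exists c1 c2 : 'I_n, [/\ mu n c1 < mu n c, mu n c2 < mu n c,
             w < tnth e c1, w < tnth e c2 & R c1 c2 (tnth e c1) (tnth e c2)])
          (pair_mark e c w).
Proof.
apply: (iffP andP) => -[wc h]; split=> //.
  by have /existsP[c1 /existsP[c2 /and5P h']] := h; exists c1, c2.
have [c1 [c2 h']] := h; apply/existsP; exists c1; apply/existsP; exists c2; exact/and5P.
Qed.

(** The entries that mark the cell further out and higher up also mark this one. *)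
Lemma pair_mark_trans e c c' x w :
  mu n c' < mu n c -> w < x -> w <= c -> pair_mark e c' x -> pair_mark e c w.
Proof.
move=> cc wx wc /pair_markP[_ [c1 [c2 [h1 h2 h3 h4 h5]]]]; apply/pair_markP.
split=> //; exists c1, c2; split=> //.
- exact: ltn_trans cc.
- exact: ltn_trans cc.
- exact: ltn_trans h3.
- exact: ltn_trans h4.
Qed.

(* A marking entry that is itself marked can be replaced by entries further out, so
   unmarked entries suffice to mark every marked cell. *)
Lemma pair_mark_stable L e e' :
  (forall c, tnth e' c = tnth e c \/
     marked L pair_mark e c /\
     (L <= tnth e' c) && pair_mark e c (tnth e' c)) ->
  forall c w, L <= w -> pair_mark e' c w = pair_mark e c w.
Proof.
move=> ee' c w Lw; apply/idP/idP; last first.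
  have [N] := ubnP (mu n c); elim: N c w Lw => // N IH c w Lw cN.
  move=> /pair_markP[wc [c1 [c2 [h1 h2 h3 h4 h5]]]].
  have [e1|[/andP[L1 m1] _]] := ee' c1; last first.
    by apply: (pair_mark_trans h1 h3 wc); apply: IH => //; apply: (leq_trans h1).
  have [e2|[/andP[L2 m2] _]] := ee' c2; last first.
    by apply: (pair_mark_trans h2 h4 wc); apply: IH => //; apply: (leq_trans h2).
  by apply/pair_markP; split=> //; exists c1, c2; rewrite e1 e2.
(* In this direction a moved witness lies in a cell that [e] marks by hypothesis, so no induction
   occurs. *)
move=> /pair_markP[wc [c1 [c2 [h1 h2 h3 h4 h5]]]].
have [e1|[_ /andP[_ m1]]] := ee' c1; last exact: pair_mark_trans h1 h3 wc m1.
have [e2|[_ /andP[_ m2]]] := ee' c2; last exact: pair_mark_trans h2 h4 wc m2.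
by apply/pair_markP; split=> //; exists c1, c2; rewrite -e1 -e2.
Qed.

Lemma pair_mark_mono L e c v w :
  L <= w <= v -> pair_mark e c v -> pair_mark e c w.
Proof.
move=> /andP[_ wv] /pair_markP[vc [c1 [c2 [h1 h2 h3 h4 h5]]]].
apply/pair_markP; split; first exact: leq_trans vc.
by exists c1, c2; split=> //; apply: leq_ltn_trans wv _.
Qed.

End PairMark.

Lemma wilf_equiv_stair L a b P Q : L <= 1 ->
  encodes L stair_mark P (bit_pattern a.+1 b) ->
  encodes L stair_mark Q (bit_pattern a b.+1) -> wilf_equiv P Q.
Proof.
move=> L1; apply: wilf_equiv_shift => // n e c v w /andP[_ wv]; exact: leq_trans.
Qed.

Lemma wilf_equiv_pair mu R L a b P Q : L <= 1 ->
  encodes L (@pair_mark mu R) P (bit_pattern a.+1 b) ->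
  encodes L (@pair_mark mu R) Q (bit_pattern a b.+1) -> wilf_equiv P Q.
Proof.
move=> L1; apply: wilf_equiv_shift => // n.
- by move=> e c v w; apply: pair_mark_mono.
- by move=> e c w _ /pair_markP[].
- by move=> e e' _ _; apply: pair_mark_stable.
Qed.

(** Shapes of the larger context: one letter, or the prefixes 22, 23 and 32. *)
Definition single (c1 c2 x1 x2 : nat) : bool := true.
Definition plateau (c1 c2 x1 x2 : nat) : bool := (c1 < c2) && (x1 == x2).
Definition ascent (c1 c2 x1 x2 : nat) : bool := (c1 < c2) && (x1 < x2).
Definition descent (c1 c2 x1 x2 : nat) : bool := (c1 < c2) && (x2 < x1).

Notation prefix_mark := (@pair_mark (fun _ c => c)).
Notation suffix_mark := (@pair_mark (fun n c => n - c)).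

(** * Translating between pattern occurrences and words in a row *)

Ltac read_occurrence i j k l :=
  move=> /contains4P[i [j [k [l [? ? ?]]]]]; rewrite order_isoE /= => ?.

Ltac show_occurrence i j k l :=
  apply/contains4P; exists i, j, k, l; rewrite order_isoE /=; split; lia.

(** Column lists whose length differs from that of the word are refuted by [//=]. *)
Ltac read_profile v c1 c2 c3 c4 marks :=
  move=> [v [? [[|c1 [|c2 [|c3 [|c4 [|? ?]]]]] []]]] //= ? marks -[]; do ?[move=> ?].

Ltac show_profile v0 columns :=
  exists v0; split; [lia | exists columns; split];
  [rewrite /=; lia | rewrite /= | rewrite /=; do ?[congr cons]; lia].

Ltac show_pair_marks c1 c2 :=
  repeat match goal with |- is_true (_ && _) => apply/andP; split end => //; try lia;
  (apply/pair_markP; split;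
   [lia | exists c1, c2; split=> //=; rewrite /plateau /ascent /descent; lia]).

Ltac encode forward backward :=
  let e := fresh "e" in let e_le := fresh "e_le" in
  let i := fresh "i" in let j := fresh "j" in let k := fresh "k" in let l := fresh "l" in
  move=> n e; rewrite inE => /forallP e_le; apply: avoids_good; split;
  [ read_occurrence i j k l;
    have := e_le i; have := e_le j; have := e_le k; have := e_le l;
    have := ltn_ord l; do 5![move=> ?]; forward e i j k l
  | let v := fresh "v" in let marks := fresh "marks" in backward e_le i j k l v marks ].

(** The first entry is 0 and serves as the leading letter; [L = 1] makes the entry in column [j]
    positive, so [j] lies to its right. *)
Ltac show_occurrence_from_0 e_le j k l :=
  let n_gt0 := fresh "n_gt0" in
  have n_gt0 := leq_ltn_trans (leq0n _) (ltn_ord j);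
  have := e_le (Ordinal n_gt0); have := e_le j; move=> /= ? ?;
  show_occurrence (Ordinal n_gt0) j k l.

Ltac encode_stair :=
  encode
    ltac:(fun e i j k l =>
      show_profile (tnth e i) [:: i; j; k; l]; rewrite /stair_mark; lia)
    ltac:(fun e_le i j k l v marks =>
      read_profile v i j k l marks; rewrite /stair_mark in marks; show_occurrence i j k l).

Ltac encode_0_stair :=
  encode
    ltac:(fun e i j k l =>
      show_profile (tnth e j) [:: j; k; l]; rewrite /stair_mark; lia)
    ltac:(fun e_le i j k l v marks =>
      read_profile v j k l i marks; rewrite /stair_mark in marks;
      show_occurrence_from_0 e_le j k l).

(** The row is the value of the ones, found in the first column of the word or, for 011, in the
    second. Backwards, the mark of the first column gives a larger entry left of the whole word. *)
Ltac encode_prefix :=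
  encode
    ltac:(fun e i j k l =>
      first [show_profile (tnth e j) [:: j; k; l] | show_profile (tnth e k) [:: j; k; l]];
      show_pair_marks i i)
    ltac:(fun e_le i j k l v marks =>
      read_profile v j k l i marks;
      have /andP[/andP[_ /pair_markP[_ [i [_ [? _ ? _ _]]]]] _] := marks;
      show_occurrence i j k l).

Ltac encode_0_prefix :=
  encode
    ltac:(fun e i j k l =>
      first [show_profile (tnth e k) [:: k; l] | show_profile (tnth e l) [:: k; l]];
      show_pair_marks j j)
    ltac:(fun e_le i j k l v marks =>
      read_profile v k l i j marks;
      have /andP[/andP[_ /pair_markP[_ [j [_ [? _ ? _ _]]]]] _] := marks;
      show_occurrence_from_0 e_le j k l).

(** Backwards, the mark of the last column is used: its larger entry is right of the whole word. *)
Ltac encode_suffix :=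
  encode
    ltac:(fun e i j k l =>
      show_profile (tnth e i) [:: i; j; k]; show_pair_marks l l)
    ltac:(fun e_le i j k l v marks =>
      read_profile v i j k l marks;
      have /and3P[_ _ /andP[/andP[_ /pair_markP[_ [l [_ [? _ ? _ _]]]]] _]] := marks;
      show_occurrence i j k l).

Ltac encode_prefix_pair :=
  encode
    ltac:(fun e i j k l =>
      first [show_profile (tnth e k) [:: k; l] | show_profile (tnth e l) [:: k; l]];
      show_pair_marks i j)
    ltac:(fun e_le i j k l v marks =>
      read_profile v k l i j marks;
      have /andP[/andP[_ /pair_markP[_ [i [j [? ? ? ? /andP[? ?]]]]]] _] := marks;
      show_occurrence i j k l).

(** * The word and context of each pattern *)

Lemma encodes1011 : encodes 0 stair_mark [:: 1; 0; 1; 1] (bit_pattern 1 2).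
Proof. encode_stair. Qed.

Lemma encodes1101 : encodes 0 stair_mark [:: 1; 1; 0; 1] (bit_pattern 2 1).
Proof. encode_stair. Qed.

Lemma encodes1110 : encodes 0 stair_mark [:: 1; 1; 1; 0] (bit_pattern 3 0).
Proof. encode_stair. Qed.

Lemma encodes2110 : encodes 0 (prefix_mark single) [:: 2; 1; 1; 0] (bit_pattern 2 0).
Proof. encode_prefix. Qed.

Lemma encodes2101 : encodes 0 (prefix_mark single) [:: 2; 1; 0; 1] (bit_pattern 1 1).
Proof. encode_prefix. Qed.

Lemma encodes2011 : encodes 0 (prefix_mark single) [:: 2; 0; 1; 1] (bit_pattern 0 2).
Proof. encode_prefix. Qed.

Lemma encodes0221 : encodes 1 stair_mark [:: 0; 2; 2; 1] (bit_pattern 2 0).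
Proof. encode_0_stair. Qed.

Lemma encodes0212 : encodes 1 stair_mark [:: 0; 2; 1; 2] (bit_pattern 1 1).
Proof. encode_0_stair. Qed.

Lemma encodes0312 : encodes 1 (prefix_mark single) [:: 0; 3; 1; 2] (bit_pattern 0 1).
Proof. encode_0_prefix. Qed.

Lemma encodes0321 : encodes 1 (prefix_mark single) [:: 0; 3; 2; 1] (bit_pattern 1 0).
Proof. encode_0_prefix. Qed.

Lemma encodes1102 : encodes 0 (suffix_mark single) [:: 1; 1; 0; 2] (bit_pattern 2 0).
Proof. encode_suffix. Qed.

Lemma encodes1012 : encodes 0 (suffix_mark single) [:: 1; 0; 1; 2] (bit_pattern 1 1).
Proof. encode_suffix. Qed.

Lemma encodes2201 : encodes 0 (prefix_mark plateau) [:: 2; 2; 0; 1] (bit_pattern 0 1).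
Proof. encode_prefix_pair. Qed.

Lemma encodes2210 : encodes 0 (prefix_mark plateau) [:: 2; 2; 1; 0] (bit_pattern 1 0).
Proof. encode_prefix_pair. Qed.

Lemma encodes2301 : encodes 0 (prefix_mark ascent) [:: 2; 3; 0; 1] (bit_pattern 0 1).
Proof. encode_prefix_pair. Qed.

Lemma encodes2310 : encodes 0 (prefix_mark ascent) [:: 2; 3; 1; 0] (bit_pattern 1 0).
Proof. encode_prefix_pair. Qed.

Lemma encodes3201 : encodes 0 (prefix_mark descent) [:: 3; 2; 0; 1] (bit_pattern 0 1).
Proof. encode_prefix_pair. Qed.

Lemma encodes3210 : encodes 0 (prefix_mark descent) [:: 3; 2; 1; 0] (bit_pattern 1 0).
Proof. encode_prefix_pair. Qed.

Lemma wilf_equiv_sym P Q : wilf_equiv P Q -> wilf_equiv Q P.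
Proof. by move=> h n /h. Qed.

Theorem theorem1p1 :
  (wilf_equiv [:: 1; 0; 1; 1] [:: 1; 1; 0; 1] /\
   wilf_equiv [:: 1; 1; 0; 1] [:: 1; 1; 1; 0]) /\
  (wilf_equiv [:: 2; 1; 1; 0] [:: 2; 1; 0; 1] /\
   wilf_equiv [:: 2; 1; 0; 1] [:: 2; 0; 1; 1]) /\
  wilf_equiv [:: 0; 2; 2; 1] [:: 0; 2; 1; 2] /\
  wilf_equiv [:: 0; 3; 1; 2] [:: 0; 3; 2; 1] /\
  wilf_equiv [:: 1; 1; 0; 2] [:: 1; 0; 1; 2] /\
  wilf_equiv [:: 2; 2; 0; 1] [:: 2; 2; 1; 0] /\
  wilf_equiv [:: 2; 3; 0; 1] [:: 2; 3; 1; 0] /\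
  wilf_equiv [:: 3; 2; 0; 1] [:: 3; 2; 1; 0].
Proof.
split; first split.
(* The shift moves a one from before the zero to after it; symmetry serves the pairs stated in the
   other order. *)
- exact/wilf_equiv_sym/(wilf_equiv_stair _ encodes1101 encodes1011).
- exact/wilf_equiv_sym/(wilf_equiv_stair _ encodes1110 encodes1101).
split; first split.
- exact: (wilf_equiv_pair _ encodes2110 encodes2101).
- exact: (wilf_equiv_pair _ encodes2101 encodes2011).
split; first exact: (wilf_equiv_stair _ encodes0221 encodes0212).
split; first exact/wilf_equiv_sym/(wilf_equiv_pair _ encodes0321 encodes0312).
split; first exact: (wilf_equiv_pair _ encodes1102 encodes1012).
split; first exact/wilf_equiv_sym/(wilf_equiv_pair _ encodes2210 encodes2201).
split; first exact/wilf_equiv_sym/(wilf_equiv_pair _ encodes2310 encodes2301).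
exact/wilf_equiv_sym/(wilf_equiv_pair _ encodes3210 encodes3201).
Qed.
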